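(* For all $\mathbf{MD}^\vee$-formulas $\phi$ and $\psi$: $\phi\models\psi$ if and only if $\phi\vdash_{\mathbf{MD}^\vee}\psi$.
   Context: **Language of $\mathbf{MD}^\vee$.** Fix a set $\mathrm{Prop}$ of propositional variables. Classical formulas: $\alpha::=p\mid\bot\mid\neg\alpha\mid\alpha\wedge\alpha\mid\alpha\otimes\alpha\mid\Box\alpha\mid\Diamond\alpha$. Formulas: $\phi::=\alpha\mid\;=\!(\alpha_1,\dots,\alpha_n,\beta)\mid\phi\wedge\phi\mid\phi\otimes\phi\mid\phi\vee\phi\mid\Box\phi\mid\Diamond\phi$, where $n\ge0$ and $\alpha,\alpha_i,\beta$ are classical. Negation applies to classical formulas only. **Team semantics.** A Kripke model is $\mathfrak{M}=(W,R,V)$ with $W\neq\emptyset$, $R\subseteq W\times W$, $V:\mathrm{Prop}\to\wp(W)$. A team is any $X\subseteq W$. $R(X)=\{w\in W\mid\exists v\in X,\ vRw\}$, $R(w)=R(\{w\})$; $XRY$ means $Y\subseteq R(X)$ and $Y\cap R(w)\ne\emptyset$ for every $w\in X$. Satisfaction: - $\mathfrak{M},X\models p$ iff $X\subseteq V(p)$; $\mathfrak{M},X\models\bot$ iff $X=\emptyset$; $\mathfrak{M},X\models\neg\alpha$ iff $\mathfrak{M},\{w\}\not\models\alpha$ for all $w\in X$. - $\mathfrak{M},X\models\phi\wedge\psi$ iff both hold on $X$; $\mathfrak{M},X\models\phi\vee\psi$ iff $\mathfrak{M},X\models\phi$ or $\mathfrak{M},X\models\psi$. - $\mathfrak{M},X\models\phi\otimes\psi$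 iff $X=Y\cup Z$ for some $Y,Z\subseteq X$ with $\mathfrak{M},Y\models\phi$, $\mathfrak{M},Z\models\psi$. - $\mathfrak{M},X\models\Box\phi$ iff $\mathfrak{M},R(X)\models\phi$; $\mathfrak{M},X\models\Diamond\phi$ iff there is $Y\subseteq W$ with $XRY$ and $\mathfrak{M},Y\models\phi$. - $\mathfrak{M},X\models\;=\!(\alpha_1,\dots,\alpha_n,\beta)$ iff for all $w,u\in X$: if ($\mathfrak{M},\{w\}\models\alpha_i\Leftrightarrow\mathfrak{M},\{u\}\models\alpha_i$) for all $1\le i\le n$, then ($\mathfrak{M},\{w\}\models\beta\Leftrightarrow\mathfrak{M},\{u\}\models\beta$). $\phi\models\psi$ means: for all models $\mathfrak{M}$ and teams $X$, $\mathfrak{M},X\models\phi$ implies $\mathfrak{M},X\models\psi$. **Natural deduction system of $\mathbf{MD}^\vee$.** ($\phi,\psi,\chi,\dots$ range over formulas, $\alpha,\alpha_i,\beta$ over classical formulas; $[\cdot]$ marks discharged assumptions; subderivations may use further undischarged assumptions unless stated otherwise.) - Conjunction: from $\phi$ and $\psi$ infer $\phi\wedge\psi$; from $\phi\wedge\psi$ infer $\phi$; from $\phi\wedge\psi$ infer $\psi$. - From $\neg\neg\alpha$ infer $\alpha$; from $\bot$ infer $\phi$. - $\neg$I: from a derivation of $\bot$ from $[\alpha]$ infer $\neg\alpha$. $\neg$E: from $\alpha$ and $\neg\alpha$ infer $\bot$. - $\Box$Mon: from $\Box\phi_1,\dots,\Box\phi_k$ ($k\ge0$) and a derivation of $\psi$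 from $[\phi_1],\dots,[\phi_k]$ having no other undischarged assumptions, infer $\Box\psi$. - $\Diamond$Mon: from $\Diamond\phi$ and a derivation of $\psi$ from $[\phi]$ having no other undischarged assumptions, infer $\Diamond\psi$. - From $\neg\Box\alpha$ infer $\Diamond\neg\alpha$; from $\Diamond\neg\alpha$ infer $\neg\Box\alpha$. - Intuitionistic disjunction: from $\phi$ infer $\phi\vee\psi$; from $\psi$ infer $\phi\vee\psi$; from $\phi\vee\psi$, a derivation of $\chi$ from $[\phi]$ and a derivation of $\chi$ from $[\psi]$, infer $\chi$. - Distributivity: from $\phi\otimes(\psi\vee\chi)$ infer $(\phi\otimes\psi)\vee(\phi\otimes\chi)$; from $\Diamond(\phi\vee\psi)$ infer $\Diamond\phi\vee\Diamond\psi$; from $\Box(\phi\vee\psi)$ infer $\Box\phi\vee\Box\psi$. - Tensor: from $\phi$ infer $\phi\otimes\psi$; from $\phi\otimes\psi$ infer $\psi\otimes\phi$; from $\phi\otimes(\psi\otimes\chi)$ infer $(\phi\otimes\psi)\otimes\chi$; from $\phi\otimes\psi$, a derivation of $\alpha$ from $[\phi]$ and a derivation of $\alpha$ from $[\psi]$ ($\alpha$ classical), infer $\alpha$; from $\phi\otimes\psi$ and a derivation of $\chi$ from $[\psi]$, infer $\phi\otimes\chi$. - Dependence atoms (both directions): $=\!(\alpha_1,\dots,\alpha_k,\beta)$ and $\bigotimes_{v\in 2^{\{1,\dots,k\}}}(\alpha_1^{v(1)}\wedge\dots\wedge\alpha_k^{v(k)}\wedge(\beta\vee\neg\beta))$ may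 be inferred from each other, where $2=\{0,1\}$, $\gamma^1=\gamma$, $\gamma^0=\neg\gamma$. $\Gamma\vdash_{\mathbf{MD}^\vee}\phi$ means there is a derivation of $\phi$ all of whose undischarged assumptions belong to $\Gamma$; $\phi\vdash\psi$ means $\{\phi\}\vdash\psi$. *)

(* Defs.v *)
From Stdlib Require List.
From mathcomp Require Import all_boot all_classical.

Set Implicit Arguments.
Unset Strict Implicit.
Unset Printing Implicit Defensive.

Local Open Scope classical_set_scope.

(* Raw syntax: a classical formula is itself a formula, so both classes are
   carved out of one type by the predicates [classical] and [wf] below.
   [Or] is the intuitionistic disjunction, [Tensor] the team one. *)
Inductive form (P : Type) : Type :=
| Var of P
| Bot
| Neg of form P
| And of form P & form P
| Tensor of form P & form P
| Or of form P & form P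
| Box of form P
| Dia of form P
| Dep of seq (form P) & form P.

Arguments Bot {P}.

Fixpoint classical (P : Type) (phi : form P) : bool :=
  match phi with
  | Var _ | Bot => true
  | Neg a | Box a | Dia a => classical a
  | And a b | Tensor a b => classical a && classical b
  | Or _ _ | Dep _ _ => false
  end.

Fixpoint wf (P : Type) (phi : form P) : bool :=
  match phi with
  | Var _ | Bot => true
  | Neg a => classical a
  | And a b | Tensor a b | Or a b => wf a && wf b
  | Box a | Dia a => wf a
  | Dep s b => all (@classical P) s && classical b
  end.

Record kripke (P : Type) : Type := Kripke {
  world : Type;
  acc : world -> world -> Prop;
  valuation : P -> set world;
  world_nonempty : [set: world] !=set0
}.

Arguments valuation {P} _ _.

Definition post (P : Type) (M : kripke P) (X : set (world M)) : set (world M) :=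
  [set w | exists2 v, X v & acc v w].

Definition team_rel (P : Type) (M : kripke P) (X Y : set (world M)) : Prop :=
  Y `<=` post X /\ forall w, X w -> Y `&` post [set w] !=set0.

(* A computing version of [List.Forall], usable under nested recursion. *)
Definition all_prop (T : Type) (Q : T -> Prop) (s : seq T) : Prop :=
  foldr (fun x rest => Q x /\ rest) True s.

Fixpoint sat (P : Type) (M : kripke P) (X : set (world M)) (phi : form P)
    {struct phi} : Prop :=
  match phi with
  | Var p => X `<=` valuation M p
  | Bot => X = set0
  | Neg a => forall w, X w -> ~ sat [set w] a
  | And a b => sat X a /\ sat X b
  | Tensor a b => exists Y Z : set (world M),
      [/\ Y `<=` X, Z `<=` X, X = Y `|` Z, sat Y a & sat Z b]
  | Or a b => sat X a \/ sat X b
  | Box a => sat (post X) a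
  | Dia a => exists2 Y : set (world M), team_rel X Y & sat Y a
  | Dep s b => forall w u, X w -> X u ->
      all_prop (fun a => sat [set w] a <-> sat [set u] a) s ->
      (sat [set w] b <-> sat [set u] b)
  end.

Definition entails (P : Type) (phi psi : form P) : Prop :=
  forall (M : kripke P) (X : set (world M)), sat X phi -> sat X psi.

Definition signed (P : Type) (a : form P) (e : bool) : form P :=
  if e then a else Neg a.

(* a_1^v(1) /\ (... /\ (a_k^v(k) /\ (b \/ ~ b))); just b \/ ~ b if k = 0 *)
Definition dep_component (P : Type) (s : seq (form P)) (b : form P)
    (v : seq bool) : form P :=
  foldr (@And P) (Or b (Neg b)) [seq signed ae.1 ae.2 | ae <- zip s v].

(* Right-nested tensor of a nonempty sequence, with no unit added at the end;
   the value on [::] is irrelevant. *)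
Fixpoint big_tensor (P : Type) (s : seq (form P)) : form P :=
  match s with
  | [::] => Bot
  | [:: phi] => phi
  | phi :: s' => Tensor phi (big_tensor s')
  end.

Definition dep_expansion (P : Type) (s : seq (form P)) (b : form P) : form P :=
  big_tensor [seq dep_component s b (tval v) | v <- enum {: (size s).-tuple bool}].

(* [nd G phi]: phi has a natural deduction derivation all of whose undischarged
   assumptions lie in G; discharging enlarges G in the subderivation.
   The rules range over well-formed formulas only: the side conditions below
   ensure that [nd G phi] implies [wf phi], so the well-formedness of the
   components of a premise needs no separate mention. *)
Inductive nd (P : Type) : set (form P) -> form P -> Prop :=
| nd_assume G phi : wf phi -> G phi -> nd G phi
| nd_andI G phi psi : nd G phi -> nd G psi -> nd G (And phi psi)
| nd_andEl G phi psi : nd G (And phi psi) -> nd G phi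
| nd_andEr G phi psi : nd G (And phi psi) -> nd G psi
| nd_dne G a : classical a -> nd G (Neg (Neg a)) -> nd G a
| nd_exfalso G phi : wf phi -> nd G Bot -> nd G phi
| nd_negI G a : classical a -> nd (a |` G) Bot -> nd G (Neg a)
| nd_negE G a : classical a -> nd G a -> nd G (Neg a) -> nd G Bot
| nd_boxMon G (phis : seq (form P)) psi :
    (forall phi, List.In phi phis -> nd G (Box phi)) ->
    nd [set phi | List.In phi phis] psi -> nd G (Box psi)
| nd_diaMon G phi psi : nd G (Dia phi) -> nd [set phi] psi -> nd G (Dia psi)
| nd_negBox G a : classical a -> nd G (Neg (Box a)) -> nd G (Dia (Neg a))
| nd_diaNeg G a : classical a -> nd G (Dia (Neg a)) -> nd G (Neg (Box a))
| nd_orIl G phi psi : wf psi -> nd G phi -> nd G (Or phi psi)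
| nd_orIr G phi psi : wf phi -> nd G psi -> nd G (Or phi psi)
| nd_orE G phi psi chi :
    nd G (Or phi psi) -> nd (phi |` G) chi -> nd (psi |` G) chi -> nd G chi
| nd_tensorOr G phi psi chi :
    nd G (Tensor phi (Or psi chi)) ->
    nd G (Or (Tensor phi psi) (Tensor phi chi))
| nd_diaOr G phi psi : nd G (Dia (Or phi psi)) -> nd G (Or (Dia phi) (Dia psi))
| nd_boxOr G phi psi : nd G (Box (Or phi psi)) -> nd G (Or (Box phi) (Box psi))
| nd_tensorI G phi psi : wf psi -> nd G phi -> nd G (Tensor phi psi)
| nd_tensorC G phi psi : nd G (Tensor phi psi) -> nd G (Tensor psi phi)
| nd_tensorA G phi psi chi :
    nd G (Tensor phi (Tensor psi chi)) -> nd G (Tensor (Tensor phi psi) chi)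
| nd_tensorE G phi psi a : classical a ->
    nd G (Tensor phi psi) -> nd (phi |` G) a -> nd (psi |` G) a -> nd G a
| nd_tensorSub G phi psi chi :
    nd G (Tensor phi psi) -> nd (psi |` G) chi -> nd G (Tensor phi chi)
| nd_depE G (s : seq (form P)) b : all (@classical P) s -> classical b ->
    nd G (Dep s b) -> nd G (dep_expansion s b)
| nd_depI G (s : seq (form P)) b : all (@classical P) s -> classical b ->
    nd G (dep_expansion s b) -> nd G (Dep s b).

(* Main.v *)
(** Classical formulas are flat, and modulo provability every formula is an
    intuitionistic disjunction of classical ones: the distributivity rules push
    disjunctions outwards, and a dependence atom is first replaced by its
    expansion.  In the canonical model of the modal logic K, the team of all
    worlds containing a classical formula [a] satisfies [a] by flatness; if it
    satisfies [b1 \/ ... \/ bn] it satisfies some [bi], so that every maximal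
    consistent set containing [a] contains [bi], and hence [a] proves [bi].
    Testing [entails] on this single team replaces the usual disjoint union of
    countermodels. *)

Require Import Defs.
From Stdlib Require List.
From mathcomp Require Import all_boot all_classical.

Set Implicit Arguments.
Unset Strict Implicit.
Unset Printing Implicit Defensive.

Local Open Scope classical_set_scope.

(** * Team semantics *)

Section Semantics.
Context {P : Type} {M : kripke P}.
Implicit Types (X Y : set (world M)) (phi : form P).

Lemma post_mono X Y : Y `<=` X -> post Y `<=` post X.
Proof. by move=> YX w [v /YX Xv vw]; exists v. Qed.

Lemma post0 : post (@set0 (world M)) = set0.
Proof. by apply/seteqP; split=> // w [v []]. Qed.

Lemma sat_mono phi X Y : Y `<=` X -> sat X phi -> sat Y phi.
Proof.
elim: phi X Y => [p||a IH|a IHa b IHb|a IHa b IHb|a IHa b IHb|a IH|a IH|s b _]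
  X Y YX /=.
- exact: subset_trans.
- by move=> X0; apply/seteqP; split=> // w /YX; rewrite X0.
- by move=> h w /YX; exact: h.
- by move=> [/(IHa _ _ YX) ? /(IHb _ _ YX)].
- move=> [Z1 [Z2 [Z1X Z2X XE h1 h2]]].
  exists (Z1 `&` Y), (Z2 `&` Y); split.
  + by move=> w [].
  + by move=> w [].
  + by rewrite -setIUl -XE; apply/seteqP; split=> [w Yw|w []//]; split=> //; exact: YX.
  + by apply: IHa h1 => w [].
  + by apply: IHb h2 => w [].
- by move=> [/(IHa _ _ YX)|/(IHb _ _ YX)]; [left|right].
- exact/IH/post_mono.
(* Successors of the smaller team are all that is kept of [Z]; every world of [Y] still sees one of
   them. *)
- move=> [Z [ZX XZ] h]; exists (Z `&` post Y); last by apply: IH h => w [].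
  split=> [w []//|w Yw]; have [v [Zv [u uw wv]]] := XZ _ (YX _ Yw).
  exists v; split; last by exists u.
  by split=> //; exists w => //; rewrite -uw.
- by move=> h w u /YX Xw /YX; exact: h.
Qed.

(** Lets one part of a tensor split be empty, and makes ex falso sound: only the empty team
    satisfies [Bot]. *)
Lemma sat0 phi : sat (@set0 (world M)) phi.
Proof.
elim: phi => [p||a IH|a IHa b IHb|a IHa b IHb|a IHa b IHb|a IH|a IH|s b _] //=.
- by exists set0, set0; rewrite setU0; split.
- by left.
- by rewrite post0.
- by exists set0; first by split.
Qed.

(* Closure under arbitrary unions, needed with overlapping or infinitely many
   teams: it yields both flatness and soundness of tensor elimination. *)
Lemma classical_union a (I : Type) (F : I -> set (world M)) X :
  classical a -> (forall w, X w -> exists2 i, F i w & sat (F i) a) -> sat X a.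
Proof.
elim: a I F X => [p||a IH|a IHa b IHb|a IHa b IHb|a IHa b IHb|a IH|a IH|s b _]
  I F X //=.
- by move=> _ h w /h [i Fw]; apply.
- by move=> _ h; apply/seteqP; split=> // w /h [i + F0]; rewrite F0.
- by move=> _ h w /h [i Fw]; apply.
- move=> /andP[ca cb] h; split; [apply: (IHa I F)|apply: (IHb I F)] => //;
    by move=> w /h [i Fw []]; exists i.
- move=> /andP[ca cb] h.
  (* The splits of the teams [F i] are not glued together: each part collects all worlds that
     satisfy the disjunct on their own, and the induction hypothesis is used on the family of
     singletons. *)
  exists [set w | X w /\ sat [set w] a], [set w | X w /\ sat [set w] b].
  split; try by move=> w [].
  + apply/seteqP; split=> [w Xw|w [[]|[]]//].
    have [i Fw [Y [Z [_ _ FE Ya Zb]]]] := h _ Xw.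
    move: Fw; rewrite FE => -[Yw|Zw]; [left|right]; split=> //.
    * by apply: sat_mono Ya => _ ->.
    * by apply: sat_mono Zb => _ ->.
  + by apply: (IHa _ (fun w => [set w])) => // w [_ wa]; exists w.
  + by apply: (IHb _ (fun w => [set w])) => // w [_ wb]; exists w.
- move=> ca h; apply: (IH I (fun i => post (F i))) => // w [v /h[i Fv Fa] vw].
  by exists i => //; exists v.
- move=> ca h; exists [set v | post X v /\ sat [set v] a].
    split=> [v []//|w Xw]; have [i Fw [Y [YF FY] Ya]] := h _ Xw.
    have [v [Yv [u uw wv]]] := FY _ Fw; exists v; split; last by exists u.
    split; first by exists w => //; rewrite -uw.
    by apply: sat_mono Ya => _ ->.
  by apply: (IH _ (fun w => [set w])) => // w [_ wb]; exists w.
Qed.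

Lemma classical_flat a X :
  classical a -> sat X a <-> (forall w, X w -> sat [set w] a).
Proof.
move=> ca; split=> [Xa w Xw|h]; first by apply: sat_mono Xa => _ ->.
by apply: (@classical_union _ _ (fun w => [set w])) => // w /h; exists w.
Qed.

(** * Singleton teams: the clauses become those of Kripke semantics *)

Lemma sat_neg1 a (w : world M) : sat [set w] (Neg a) <-> ~ sat [set w] a.
Proof. by split=> [|h _ ->//] /(_ _ erefl). Qed.

Lemma sat_tensor1 a b (w : world M) :
  sat [set w] (Tensor a b) <-> sat [set w] a \/ sat [set w] b.
Proof.
split=> [[Y [Z [_ _ wE Ya Zb]]]|[h|h]].
- have : [set w] w by [].
  by rewrite {1}wE => -[Yw|Zw]; [left; apply: sat_mono Ya|right; apply: sat_mono Zb] => _ ->.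
- by exists [set w], set0; rewrite setU0; split=> //; exact: sat0.
- by exists set0, [set w]; rewrite set0U; split=> //; exact: sat0.
Qed.

Lemma sat_box1 a (w : world M) : classical a ->
  sat [set w] (Box a) <-> (forall v, acc w v -> sat [set v] a).
Proof.
move=> ca /=; rewrite classical_flat//; split=> h v.
  by move=> wv; apply: h; exists w.
by move=> [_ -> /h].
Qed.

Lemma sat_dia1 a (w : world M) : classical a ->
  sat [set w] (Dia a) <-> (exists2 v, acc w v & sat [set v] a).
Proof.
move=> ca /=; split=> [[Y [Yw wY] Ya]|[v wv va]].
  have [v [Yv [_ -> wv]]] := wY _ erefl; exists v => //.
  by apply: sat_mono Ya => _ ->.
exists [set v] => //; split=> [_ ->|_ ->]; first by exists w.
by exists v; split=> //; exists w.
Qed.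

(** * Semantics of the dependence expansion *)

Definition truth_values (s : seq (form P)) (w : world M) : seq bool :=
  [seq `[< sat [set w] a >] | a <- s].

Lemma sat_signed a e X : classical a ->
  sat X (signed a e) <-> (forall w, X w -> `[< sat [set w] a >] = e).
Proof.
case: e => ca /=.
  rewrite classical_flat//; split=> h w /h; first by move=> ?; exact/asboolP.
  by move=> /asboolP.
split=> h w /h; first by move=> ?; exact/asboolPn.
by move=> /asboolPn.
Qed.

(** The intuitionistic disjunction is evaluated on the whole team, so for classical [b] a component
    describes a team inside a single truth-value class on which [b] is constant. *)
Lemma sat_dep_component s b v X : all (@classical P) s -> size v = size s ->
  sat X (dep_component s b v) <->
  (forall w, X w -> truth_values s w = v) /\ (sat X b \/ sat X (Neg b)).
Proof.
rewrite /dep_component; elim: s v => [|a s IH] [|e v] //=.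
  by move=> _ _; split=> [|[]].
move=> /andP[ca cs] [sv]; rewrite IH// sat_signed//.
split=> [[h1 [h2 h3]]|[h1 h2]].
  by split=> // w Xw; rewrite /truth_values/= h1// -/(truth_values _ _) h2.
by split; [|split=> //] => w /h1 [].
Qed.

Lemma all_prop_truth_values s (w u : world M) :
  all_prop (fun a => sat [set w] a <-> sat [set u] a) s <->
  truth_values s w = truth_values s u.
Proof.
elim: s => [|a s IH] //=; rewrite IH; split=> [[h1 h2]|[h1 h2]].
  by rewrite /truth_values/= (propext h1) -!/(truth_values _ _) h2.
by split=> //; split=> /asboolP; [rewrite h1|rewrite -h1] => /asboolP.
Qed.

(** By downward closure a cover of [X] by sets that may overlap or leave [X] is as good as a split
    into subteams; a cover is indexed directly by [I] and avoids nested unions. *)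
Lemma sat_big_tensor (I : eqType) (f : I -> form P) (l : seq I) X :
  uniq l -> l != [::] ->
  sat X (big_tensor [seq f i | i <- l]) <->
  exists Y : I -> set (world M),
    (forall w, X w -> exists2 i, i \in l & Y i w) /\
    (forall i, i \in l -> sat (Y i) (f i)).
Proof.
elim: l X => [//|i l IH] X; case: l IH => [_ _ _|j l IH].
  split=> [h|[Y [XY Yf]]] /=.
    exists (fun=> X); split=> [w|j]; first by exists i; rewrite ?mem_head.
    by rewrite inE => /eqP ->.
  apply: (sat_mono _ (Yf _ (mem_head _ _))) => w /XY [j].
  by rewrite inE => /eqP ->.
rewrite cons_uniq => /andP[il ul] _; rewrite [map _ _]/=.
rewrite [big_tensor _]/= -/(big_tensor (f j :: _)) -(map_cons f j l).
split.
  move=> [Y1 [Y2 [_ _ -> Y1i /(IH _ ul isT)[Y [Y2Y Yf]]]]].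
  (* Since [i] does not occur in the tail, assigning it [Y1] changes the set of no other index. *)
  exists (fun k => if k == i then Y1 else Y k); split.
    move=> w [Y1w|/Y2Y [k kl Ykw]].
      by exists i; rewrite ?eqxx ?mem_head.
    exists k; first by rewrite in_cons kl orbT.
    by case: eqP il => [<-|//]; rewrite kl.
  by move=> k; rewrite in_cons; case: eqP => [-> //|_]; exact: Yf.
move=> [Y [XY Yf]].
exists (X `&` Y i), (X `&` [set w | exists2 k, k \in j :: l & Y k w]); split.
- by move=> w [].
- by move=> w [].
- apply/seteqP; split=> [w Xw|w [[]|[]]//].
  have [k + Yk] := XY _ Xw; rewrite in_cons => /orP[/eqP kE|kl].
    by left; split; rewrite -?kE.
  by right; split=> //; exists k.
- by apply: sat_mono (Yf _ (mem_head _ _)) => w [].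
- apply/(IH _ ul isT); exists Y; split=> [w []//|k kl].
  by apply: Yf; rewrite in_cons kl orbT.
Qed.

(** The components sort worlds by their truth values on [s], and the atom says that [b] is constant
    on each class. *)
Lemma sat_dep_expansion s b X : all (@classical P) s -> classical b ->
  sat X (dep_expansion s b) <-> sat X (Dep s b).
Proof.
move=> cs cb; rewrite /dep_expansion.
rewrite (@sat_big_tensor _ (fun v => dep_component s b (tval v)))
  ?enum_uniq//; last first.
  (* There are 2^k sign vectors, hence at least one, even for k = 0. *)
  rewrite -size_eq0 -cardE card_tuple card_bool.
  by rewrite expn_eq0.
split.
  move=> [Y [XY Yf]] w u Xw Xu /all_prop_truth_values tE.
  have [i _ Yi] := XY _ Xw; have [j _ Yj] := XY _ Xu.
  have /sat_dep_component [//||ti bi] := Yf i (mem_enum _ _).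
    by rewrite size_tuple.
  have /sat_dep_component [//||tj _] := Yf j (mem_enum _ _).
    by rewrite size_tuple.
  (* Both indices equal the common truth-value vector of [w] and [u], so the two worlds lie in one
     component, where [b] is constant. *)
  have ij : i = j by apply: val_inj; rewrite /= -(ti _ Yi) -(tj _ Yj).
  rewrite -ij in Yj; case: bi => bi.
    by move/classical_flat: bi => /(_ cb) bi; split=> _; exact: bi.
  by split=> h; [case: (bi _ Yi)|case: (bi _ Yj)].
move=> h; exists (fun v => [set w | X w /\ truth_values s w = tval v]).
split=> [w Xw|v _].
  have st : size (truth_values s w) == size s by rewrite size_map.
  by exists (Tuple st); rewrite ?mem_enum.
apply/sat_dep_component; rewrite ?size_tuple//; split=> [w []//|].
have [[u [Xu tu] ub]|nb] :=
  pselect (exists2 u, X u /\ truth_values s u = tval v & sat [set u] b).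
  left; apply/classical_flat => // w [Xw tw].
  by apply/(h u w) => //; apply/all_prop_truth_values; rewrite tu.
by right=> w Xw wb; apply: nb; exists w.
Qed.

End Semantics.

(** * Soundness *)

(** The team stays universally quantified in the induction: subderivations are evaluated on
    singletons, on successor teams and on the parts of a tensor split. Side assumptions reach
    subteams by downward closure. *)
Lemma nd_sound {P : Type} (G : set (form P)) phi : nd G phi ->
  forall (M : kripke P) (X : set (world M)),
    (forall g, G g -> sat X g) -> sat X phi.
Proof.
elim=> {G phi}.
- by move=> G phi _ Gphi M X; apply.
- by move=> G phi psi _ IH1 _ IH2 M X XG; split; [exact: IH1|exact: IH2].
- by move=> G phi psi _ IH M X /IH [].
- by move=> G phi psi _ IH M X /IH [].
- move=> G a ca _ IH M X /IH h; apply/classical_flat => // w Xw.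
  by apply: contrapT => na; apply: (h w Xw); exact/sat_neg1.
- by move=> G phi _ _ IH M X /IH ->; exact: sat0.
- move=> G a ca _ IH M X XG w Xw wa.
  have : sat [set w] (@Bot P).
    by apply: IH => g [->//|/XG]; apply: sat_mono => _ ->.
  by move=> /= /seteqP [+ _] => /(_ w erefl).
- move=> G a ca _ IH1 _ IH2 M X XG; apply/seteqP; split=> // w Xw.
  apply: (IH2 _ _ XG w Xw).
  by apply: sat_mono (IH1 _ _ XG) => _ ->.
- by move=> G phis psi _ IH1 _ IH2 M X XG; apply: IH2 => g /IH1; apply.
- move=> G phi psi _ IH1 _ IH2 M X /IH1 [Y XY Yphi]; exists Y => //.
  by apply: IH2 => _ ->.
- move=> G a ca _ IH M X /IH h; apply/(@classical_flat _ _ (Dia (Neg a))) => // w Xw.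
  have : ~ sat [set w] (Box a) by exact: h.
  rewrite sat_box1// sat_dia1// => /existsNP[v /not_implyP[wv va]].
  by exists v => //; apply/sat_neg1.
- move=> G a ca _ IH M X /IH h w Xw /(sat_box1 _ ca) wa.
  have : sat [set w] (Dia (Neg a)) by apply: sat_mono h => _ ->.
  by rewrite sat_dia1// => -[v /wa va /sat_neg1].
- by move=> G phi psi _ _ IH M X /IH; left.
- by move=> G phi psi _ _ IH M X /IH; right.
- move=> G phi psi chi _ IH _ IH1 _ IH2 M X XG.
  by case: (IH _ _ XG) => h; [apply: IH1|apply: IH2] => g [->//|/XG].
- move=> G phi psi chi _ IH M X /IH [Y [Z [YX ZX XE Yh [Zh|Zh]]]];
    [left|right]; by exists Y, Z.
- by move=> G phi psi _ IH M X /IH [Y XY [Yh|Yh]]; [left|right]; exists Y.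
- by move=> G phi psi _ IH M X /IH [h|h]; [left|right].
- move=> G phi psi _ _ IH M X /IH h; exists X, set0; rewrite setU0.
  by split=> //; exact: sat0.
- move=> G phi psi _ IH M X /IH [Y [Z [YX ZX XE Yh Zh]]].
  by exists Z, Y; rewrite setUC.
- move=> G phi psi chi _ IH M X /IH [Y [Z [YX ZX XE Yh [Z1 [Z2 [Z1Z Z2Z ZE h1 h2]]]]]].
  exists (Y `|` Z1), Z2; split=> //.
  + by move=> w [/YX|/Z1Z/ZX].
  + by move=> w /Z2Z/ZX.
  + by rewrite XE ZE setUA.
  + by exists Y, Z1; split.
- move=> G phi psi a ca _ IH _ IH1 _ IH2 M X XG.
  have [Y [Z [YX ZX XE Yh Zh]]] := IH _ _ XG.
  (* The two parts form a family indexed by [bool]; this is where the conclusion has to be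
     classical. *)
  apply: (@classical_union _ _ _ bool (fun b => if b then Y else Z)) => // w.
  rewrite XE => -[Yw|Zw]; [exists true|exists false] => //.
    by apply: IH1 => g [->//|/XG]; exact: sat_mono.
  by apply: IH2 => g [->//|/XG]; exact: sat_mono.
- move=> G phi psi chi _ IH _ IH1 M X XG.
  have [Y [Z [YX ZX XE Yh Zh]]] := IH _ _ XG.
  exists Y, Z; split=> //.
  by apply: IH1 => g [->//|/XG]; exact: sat_mono.
- by move=> G s b cs cb _ IH M X /IH /sat_dep_expansion; apply.
- by move=> G s b cs cb _ IH M X /IH /sat_dep_expansion; apply.
Qed.

(** * Normal forms *)

Section ProofTheory.
Context {P : Type}.
Implicit Types (G H : set (form P)) (a b phi psi chi : form P).

Lemma classical_wf a : classical a -> wf a.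
Proof.
by elim: a => //= a IHa b IHb /andP[/IHa-> /IHb->].
Qed.

(** The modal rules fix the context of their subderivation, so there only the premises are weakened;
    the other discharging rules use monotonicity of union. *)
Lemma nd_weaken G H phi : G `<=` H -> nd G phi -> nd H phi.
Proof.
move=> + h; elim: h H => {G phi}.
- by move=> G phi wphi Gphi H GH; apply: nd_assume => //; exact: GH.
- by move=> G phi psi _ IH1 _ IH2 H GH; apply: nd_andI; auto.
- by move=> G phi psi _ IH H GH; apply: nd_andEl; apply: IH.
- by move=> G phi psi _ IH H GH; apply: nd_andEr; apply: IH.
- by move=> G a ca _ IH H GH; apply: nd_dne => //; apply: IH.
- by move=> G a ca _ IH H GH; apply: nd_exfalso => //; apply: IH.
- by move=> G a ca _ IH H GH; apply: nd_negI => //; apply: IH; exact: setUS.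
- by move=> G a ca _ IH1 _ IH2 H GH; apply: (nd_negE (a := a)); auto.
- by move=> G phis psi _ IH1 h _ H GH; apply: nd_boxMon h => phi /IH1; apply.
- by move=> G phi psi _ IH1 h _ H GH; apply: nd_diaMon h; exact: IH1.
- by move=> G a ca _ IH H GH; apply: nd_negBox => //; apply: IH.
- by move=> G a ca _ IH H GH; apply: nd_diaNeg => //; apply: IH.
- by move=> G phi psi w _ IH H GH; apply: nd_orIl => //; apply: IH.
- by move=> G phi psi w _ IH H GH; apply: nd_orIr => //; apply: IH.
- move=> G phi psi chi _ IH _ IH1 _ IH2 H GH; apply: nd_orE; first exact: IH.
    by apply: IH1; exact: setUS.
  by apply: IH2; exact: setUS.
- by move=> G phi psi chi _ IH H GH; apply: nd_tensorOr; exact: IH.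
- by move=> G phi psi _ IH H GH; apply: nd_diaOr; exact: IH.
- by move=> G phi psi _ IH H GH; apply: nd_boxOr; exact: IH.
- by move=> G phi psi w _ IH H GH; apply: nd_tensorI => //; exact: IH.
- by move=> G phi psi _ IH H GH; apply: nd_tensorC; exact: IH.
- by move=> G phi psi chi _ IH H GH; apply: nd_tensorA; exact: IH.
- move=> G phi psi a ca _ IH _ IH1 _ IH2 H GH.
  apply: nd_tensorE => //; first exact: IH.
    by apply: IH1; exact: setUS.
  by apply: IH2; exact: setUS.
- move=> G phi psi chi _ IH _ IH1 H GH; apply: nd_tensorSub; first exact: IH.
  by apply: IH1; exact: setUS.
- by move=> G s b cs cb _ IH H GH; apply: nd_depE => //; exact: IH.
- by move=> G s b cs cb _ IH H GH; apply: nd_depI => //; exact: IH.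
Qed.

(* The calculus has no implication; cut is disjunction elimination on
   [phi \/ phi]. *)
Lemma nd_cut G phi psi : wf phi -> nd G phi -> nd (phi |` G) psi -> nd G psi.
Proof. by move=> wphi h1 h2; apply: (nd_orE _ h2 h2); exact: nd_orIl. Qed.

Lemma nd_cut1 G phi psi : wf phi -> nd G phi -> nd [set phi] psi -> nd G psi.
Proof. by move=> w h1 h2; apply: nd_cut w h1 _; apply: nd_weaken h2; left. Qed.

Lemma nd_hyp phi : wf phi -> nd [set phi] phi.
Proof. by move=> w; apply: nd_assume. Qed.

Lemma nd_hypU G phi : wf phi -> nd (phi |` G) phi.
Proof. by move=> w; apply: nd_assume => //; left. Qed.

(** Well-formedness of both sides is carried along because cut requires it; transitivity and the
    congruences then need no side conditions. *)
Definition eqv phi psi : Prop :=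
  [/\ wf phi, wf psi, nd [set phi] psi & nd [set psi] phi].

Lemma eqv_refl phi : wf phi -> eqv phi phi.
Proof. by move=> w; split=> //; exact: nd_hyp. Qed.

Lemma eqv_trans phi psi chi : eqv phi psi -> eqv psi chi -> eqv phi chi.
Proof.
move=> [w1 w2 h1 h2] [_ w3 h3 h4]; split=> //; [exact: nd_cut1 h1 h3|].
exact: nd_cut1 h4 h2.
Qed.

(** * Congruence and distributivity up to provable equivalence *)

Lemma nd_and2 phi phi' psi psi' : wf phi -> wf psi ->
  nd [set phi] phi' -> nd [set psi] psi' -> nd [set And phi psi] (And phi' psi').
Proof.
move=> w1 w2 h1 h2; have h : nd [set And phi psi] (And phi psi).
  by apply: nd_hyp; rewrite /= w1.
apply: nd_andI; first by apply: nd_cut1 h1 => //; exact: nd_andEl h.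
by apply: nd_cut1 h2 => //; exact: nd_andEr h.
Qed.

(** Substitution acts on the right factor only, so the left one is treated between two uses of
    commutativity. *)
Lemma nd_tensor2 phi phi' psi psi' : wf phi -> wf psi ->
  nd [set phi] phi' -> nd [set psi] psi' ->
  nd [set Tensor phi psi] (Tensor phi' psi').
Proof.
move=> w1 w2 h1 h2.
apply: (@nd_tensorSub _ _ _ psi); last by apply: nd_weaken h2; left.
apply: nd_tensorC; apply: (@nd_tensorSub _ _ _ phi).
  by apply: nd_tensorC; apply: nd_hyp; rewrite /= w1.
by apply: nd_weaken h1; left.
Qed.

Lemma nd_or2 G phi phi' psi psi' : wf phi' -> wf psi' -> nd G (Or phi psi) ->
  nd [set phi] phi' -> nd [set psi] psi' -> nd G (Or phi' psi').
Proof.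
move=> w1 w2 h h1 h2; apply: nd_orE h _ _.
  by apply: nd_orIl => //; apply: nd_weaken h1; left.
by apply: nd_orIr => //; apply: nd_weaken h2; left.
Qed.

Lemma nd_box1 phi psi : wf phi -> nd [set phi] psi -> nd [set Box phi] (Box psi).
Proof.
move=> w h; apply: (@nd_boxMon _ _ [:: phi]) => [c [<-|//]|]; first exact: nd_hyp.
by apply: nd_weaken h => _ ->; left.
Qed.

Lemma nd_dia1 phi psi : wf phi -> nd [set phi] psi -> nd [set Dia phi] (Dia psi).
Proof. by move=> w; apply: nd_diaMon; exact: nd_hyp. Qed.

Lemma nd_orE1 phi psi chi : wf phi -> wf psi ->
  nd [set phi] chi -> nd [set psi] chi -> nd [set Or phi psi] chi.
Proof.
move=> w1 w2 h1 h2; apply: nd_orE; first by apply: nd_hyp; rewrite /= w1.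
  by apply: nd_weaken h1; left.
by apply: nd_weaken h2; left.
Qed.

Lemma eqv_and phi phi' psi psi' :
  eqv phi phi' -> eqv psi psi' -> eqv (And phi psi) (And phi' psi').
Proof.
by move=> [w1 w2 h1 h2] [w3 w4 h3 h4]; split; rewrite /= ?w1 ?w2//; exact: nd_and2.
Qed.

Lemma eqv_tensor phi phi' psi psi' :
  eqv phi phi' -> eqv psi psi' -> eqv (Tensor phi psi) (Tensor phi' psi').
Proof.
by move=> [w1 w2 h1 h2] [w3 w4 h3 h4]; split; rewrite /= ?w1 ?w2//; exact: nd_tensor2.
Qed.

Lemma eqv_or phi phi' psi psi' :
  eqv phi phi' -> eqv psi psi' -> eqv (Or phi psi) (Or phi' psi').
Proof.
move=> [w1 w2 h1 h2] [w3 w4 h3 h4]; split; rewrite /= ?w1 ?w2//.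
  by apply: nd_or2 h1 h3 => //; apply: nd_hyp; rewrite /= w1.
by apply: nd_or2 h2 h4 => //; apply: nd_hyp; rewrite /= w2.
Qed.

Lemma eqv_box phi psi : eqv phi psi -> eqv (Box phi) (Box psi).
Proof. by move=> [w1 w2 h1 h2]; split=> //; exact: nd_box1. Qed.

Lemma eqv_dia phi psi : eqv phi psi -> eqv (Dia phi) (Dia psi).
Proof. by move=> [w1 w2 h1 h2]; split=> //; exact: nd_dia1. Qed.

Lemma eqv_andC phi psi : wf phi -> wf psi -> eqv (And phi psi) (And psi phi).
Proof.
have comm a b : wf a -> wf b -> nd [set And a b] (And b a).
  move=> wa wb; have h : nd [set And a b] (And a b).
    by apply: nd_hyp; rewrite /= wa.
  by apply: nd_andI; [exact: nd_andEr h|exact: nd_andEl h].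
by move=> w1 w2; split; rewrite /= ?w1 ?w2//; exact: comm.
Qed.

Lemma eqv_tensorC phi psi :
  wf phi -> wf psi -> eqv (Tensor phi psi) (Tensor psi phi).
Proof.
by move=> w1 w2; split; rewrite /= ?w1 ?w2//; apply: nd_tensorC;
  apply: nd_hyp; rewrite /= w1 w2.
Qed.

(** The calculus has no such distributivity rule for conjunction; disjunction elimination provides
    it. For the tensor and the modalities below, the forward direction is a rule and the converse
    follows from monotonicity. *)
Lemma eqv_and_or phi psi chi : wf phi -> wf psi -> wf chi ->
  eqv (And phi (Or psi chi)) (Or (And phi psi) (And phi chi)).
Proof.
move=> w1 w2 w3; split; rewrite /= ?w1 ?w2 ?w3//.
  set G := [set _]; have h : nd G (And phi (Or psi chi)).
    by apply: nd_hyp; rewrite /= w1 w2.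
  have hphi a : nd (a |` G) phi.
    by apply: nd_weaken (nd_andEl h); right.
  apply: (nd_orE (nd_andEr h)); [apply: nd_orIl|apply: nd_orIr];
    rewrite /= ?w1 ?w2 ?w3//; by apply: nd_andI => //; exact: nd_hypU.
apply: nd_orE1; rewrite /= ?w1 ?w2 ?w3//; apply: nd_and2 => //.
- exact: nd_hyp.
- by apply: nd_orIl => //; exact: nd_hyp.
- exact: nd_hyp.
- by apply: nd_orIr => //; exact: nd_hyp.
Qed.

Lemma eqv_tensor_or phi psi chi : wf phi -> wf psi -> wf chi ->
  eqv (Tensor phi (Or psi chi)) (Or (Tensor phi psi) (Tensor phi chi)).
Proof.
move=> w1 w2 w3; split; rewrite /= ?w1 ?w2 ?w3//.
  by apply: nd_tensorOr; apply: nd_hyp; rewrite /= w1 w2.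
apply: nd_orE1; rewrite /= ?w1 ?w2 ?w3//; apply: nd_tensor2 => //.
- exact: nd_hyp.
- by apply: nd_orIl => //; exact: nd_hyp.
- exact: nd_hyp.
- by apply: nd_orIr => //; exact: nd_hyp.
Qed.

Lemma eqv_box_or phi psi : wf phi -> wf psi ->
  eqv (Box (Or phi psi)) (Or (Box phi) (Box psi)).
Proof.
move=> w1 w2; split; rewrite /= ?w1 ?w2//.
  by apply: nd_boxOr; apply: nd_hyp; rewrite /= w1.
apply: nd_orE1 => //; apply: nd_box1 => //; [apply: nd_orIl|apply: nd_orIr] => //;
  exact: nd_hyp.
Qed.

Lemma eqv_dia_or phi psi : wf phi -> wf psi ->
  eqv (Dia (Or phi psi)) (Or (Dia phi) (Dia psi)).
Proof.
move=> w1 w2; split; rewrite /= ?w1 ?w2//.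
  by apply: nd_diaOr; apply: nd_hyp; rewrite /= w1.
apply: nd_orE1 => //; apply: nd_dia1 => //; [apply: nd_orIl|apply: nd_orIr] => //;
  exact: nd_hyp.
Qed.

(** * Disjunctions of classical formulas *)

(** Any bracketing is allowed, so two normal forms are joined by [Or] without reassociating. *)
Inductive or_normal : form P -> Prop :=
| or_normal_classical a : classical a -> or_normal a
| or_normal_or phi psi : or_normal phi -> or_normal psi -> or_normal (Or phi psi).

Lemma or_normal_wf phi : or_normal phi -> wf phi.
Proof. by elim=> {phi} [a /classical_wf//|phi psi _ /= -> _ ->]. Qed.

Definition normalizable phi : Prop := exists2 psi, or_normal psi & eqv phi psi.

Lemma normalizable_eqv phi psi :
  eqv phi psi -> normalizable psi -> normalizable phi.
Proof. by move=> e [chi n e']; exists chi => //; exact: eqv_trans e e'. Qed.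

Lemma normalizable_or phi psi :
  normalizable phi -> normalizable psi -> normalizable (Or phi psi).
Proof.
move=> [phi' n1 e1] [psi' n2 e2]; exists (Or phi' psi'); last exact: eqv_or.
exact: or_normal_or.
Qed.

Lemma normalizable_classical a : classical a -> normalizable a.
Proof.
move=> ca; exists a; first exact: or_normal_classical.
exact/eqv_refl/classical_wf.
Qed.

(** Shared by the two modalities: after replacing the argument by a normal form, induction on that
    form pushes [op] down to the classical leaves. *)
Lemma normalizable_unary (op : form P -> form P) :
  (forall a, classical a -> classical (op a)) ->
  (forall phi psi, eqv phi psi -> eqv (op phi) (op psi)) ->
  (forall phi psi, wf phi -> wf psi ->
     eqv (op (Or phi psi)) (Or (op phi) (op psi))) ->
  forall phi, normalizable phi -> normalizable (op phi).
Proof.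
move=> opc ope opor phi [psi n /ope e]; apply: normalizable_eqv e _.
elim: n => {phi psi} [a /opc/normalizable_classical//|phi psi n1 IH1 n2 IH2].
apply: normalizable_eqv (normalizable_or IH1 IH2).
by apply: opor; exact: or_normal_wf.
Qed.

(** Shared by conjunction and tensor. Distributivity is assumed on the right only; commutativity
    brings the left argument into that position. *)
Lemma normalizable_binary (op : form P -> form P -> form P) :
  (forall a b, classical a -> classical b -> classical (op a b)) ->
  (forall phi phi' psi psi',
     eqv phi phi' -> eqv psi psi' -> eqv (op phi psi) (op phi' psi')) ->
  (forall phi psi, wf phi -> wf psi -> eqv (op phi psi) (op psi phi)) ->
  (forall phi psi chi, wf phi -> wf psi -> wf chi ->
     eqv (op phi (Or psi chi)) (Or (op phi psi) (op phi chi))) ->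
  forall phi psi, normalizable phi -> normalizable psi ->
    normalizable (op phi psi).
Proof.
move=> opc ope opC opor phi psi [phi' n1 e1] [psi' n2 e2].
apply: normalizable_eqv (ope _ _ _ _ e1 e2) _ => {phi psi e1 e2}.
elim: n2 => {psi'} [b cb|psi chi n2 IH2 n3 IH3]; last first.
  apply: normalizable_eqv (normalizable_or IH2 IH3).
  by apply: opor; exact: or_normal_wf.
have wb := classical_wf cb.
(* The right argument is now classical, so swapping exposes the other normal form to
   distributivity. *)
apply: normalizable_eqv (opC _ _ (or_normal_wf n1) wb) _.
elim: n1 => {phi'} [a ca|phi psi n2 IH2 n3 IH3].
  exact/normalizable_classical/opc.
apply: normalizable_eqv (normalizable_or IH2 IH3).
by apply: opor => //; exact: or_normal_wf.
Qed.

Lemma normalizable_and phi psi :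
  normalizable phi -> normalizable psi -> normalizable (And phi psi).
Proof.
apply: normalizable_binary; [|exact: eqv_and|exact: eqv_andC|exact: eqv_and_or].
by move=> a b /= -> ->.
Qed.

Lemma normalizable_tensor phi psi :
  normalizable phi -> normalizable psi -> normalizable (Tensor phi psi).
Proof.
apply: normalizable_binary;
  [|exact: eqv_tensor|exact: eqv_tensorC|exact: eqv_tensor_or].
by move=> a b /= -> ->.
Qed.

Lemma normalizable_dep_component s b v : all (@classical P) s -> classical b ->
  normalizable (dep_component s b v).
Proof.
rewrite /dep_component => + cb; elim: s v => [|a s IH] [|e v] /=;
  try by move=> _; apply: normalizable_or; apply: normalizable_classical.
move=> /andP[ca cs]; apply: normalizable_and (IH _ cs).
by case: e; exact: normalizable_classical.
Qed.

Lemma normalizable_big_tensor (I : Type) (f : I -> form P) (l : seq I) :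
  (forall i, normalizable (f i)) -> normalizable (big_tensor [seq f i | i <- l]).
Proof.
move=> nf; elim: l => [|i [|j l] IH] /=; first exact: normalizable_classical.
  exact: nf.
exact: normalizable_tensor (nf i) IH.
Qed.

Lemma normalizable_wf phi : wf phi -> normalizable phi.
Proof.
elim: phi => [p||a _|a IHa b IHb|a IHa b IHb|a IHa b IHb|a IH|a IH|s b _] /=.
- by move=> _; exact: normalizable_classical.
- by move=> _; exact: normalizable_classical.
- by move=> ca; exact: normalizable_classical.
- by move=> /andP[/IHa na /IHb]; exact: normalizable_and.
- by move=> /andP[/IHa na /IHb]; exact: normalizable_tensor.
- by move=> /andP[/IHa na /IHb]; exact: normalizable_or.
- move=> /IH; apply: normalizable_unary => //; first exact: eqv_box.
  exact: eqv_box_or.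
- move=> /IH; apply: normalizable_unary => //; first exact: eqv_dia.
  exact: eqv_dia_or.
- move=> /andP[cs cb].
  have /normalizable_big_tensor - /(_ (enum {: (size s).-tuple bool})) n :
      forall v : (size s).-tuple bool, normalizable (dep_component s b v).
    by move=> v; exact: normalizable_dep_component.
  (* The equivalence with the normal form already certifies that the expansion is well-formed. *)
  have wexp : wf (dep_expansion s b) by case: n => ? _ [].
  apply: normalizable_eqv n; split=> //; first by rewrite /= cs.
    by apply: nd_depE => //; apply: nd_hyp; rewrite /= cs.
  by apply: nd_depI => //; exact: nd_hyp.
Qed.

(** * Canonical model *)

(* The finite list makes unions of chains of consistent sets consistent without
   a compactness theorem for [nd]. *)
Definition inconsistent G : Prop := exists2 s : seq (form P),
  (forall a, List.In a s -> G a) & nd [set a | List.In a s] Bot.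

(** Splitting the occurrences of [a] off the list gives the shape that negation introduction and cut
    discharge. *)
Lemma inconsistentU1 G a : inconsistent (a |` G) ->
  exists2 s : seq (form P), (forall b, List.In b s -> G b) &
    nd (a |` [set b | List.In b s]) Bot.
Proof.
move=> [s sG sbot].
have [t tG st] : exists2 t : seq (form P), (forall b, List.In b t -> G b) &
    [set b | List.In b s] `<=` a |` [set b | List.In b t].
  elim: s sG {sbot} => [|b s IH] sG; first by exists [::].
  have [|t tG st] := IH; first by move=> c cs; apply: sG; right.
  have [ba|Gb] : (a |` G) b by apply: sG; left.
    by exists t => // c [<-|/st//]; left.
  exists (b :: t) => [c [<-//|/tG//]|c [<-|/st[->|ct]]];
    by [left|right; left|right; right].
by exists t => //; apply: nd_weaken sbot.
Qed.

(** Membership and maximality concern classical formulas only, so that every candidate formula has a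
    negation. *)
Record maximal_consistent (w : set (form P)) : Prop := {
  mcs_classical : forall a, w a -> classical a;
  mcs_consistent : ~ inconsistent w;
  mcs_maximal : forall a, classical a -> ~ w a -> inconsistent (a |` w)
}.

Lemma lindenbaum G : (forall a, G a -> classical a) -> ~ inconsistent G ->
  exists2 w, maximal_consistent w & G `<=` w.
Proof.
move=> cG consG.
(* Zorn is applied to the sets consistent together with [G], not to those containing [G]: this way
   the empty chain, whose union is empty, satisfies the chain condition too. *)
pose Q := [set A : set (form P) |
  (forall a, A a -> classical a) /\ ~ inconsistent (G `|` A)].
have [|A [[cA consA] maxA]] := @Zorn_bigcup _ Q.
  move=> F FQ Ftot; split=> [a [A /FQ[cA _] /cA//]|[s sF sbot]].
  (* A finite list meets only finitely many members of the chain, so one member absorbs it; the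
     first alternative covers lists drawn from [G] alone, as for the empty chain. *)
  have [sG|[A FA sA]] : (forall a, List.In a s -> G a) \/
      exists2 A, F A & forall a, List.In a s -> (G `|` A) a.
    elim: s sF {sbot} => [|a s IH] sF; first by left.
    have Ga : (G `|` \bigcup_(A in F) A) a by apply: sF; left.
    have [|sG|[A FA sA]] := IH; first by move=> b bs; apply: sF; right.
      case: Ga => [Ga|[A FA Aa]]; first by left=> b [<-//|/sG].
      by right; exists A => // b [<-|/sG]; [right|left].
    right; case: Ga => [Ga|[B FB Ba]].
      by exists A => // b [<-|/sA//]; left.
    have [AB|BA] := Ftot _ _ FA FB.
      by exists B => // b [<-|/sA[Gb|/AB]]; [right|left|right].
    by exists A => // b [<-|/sA//]; right; exact: BA.
  - by apply: consG; exists s.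
  - by have [_] := FQ _ FA; apply; exists s.
exists (G `|` A); last by left.
split=> // [a [/cG|/cA]//|a ca na].
apply: contrapT => cons; apply: (maxA (a |` A)).
  split; first by right.
  by move=> /(_ a (or_introl erefl)) Aa; apply: na; right.
split=> [b [->//|/cA//]|]; by rewrite setUCA.
Qed.

(** * Maximal consistent sets and the connectives *)

Section MaximalConsistent.
Context {w : set (form P)} (mw : maximal_consistent w).

(** If [a] were missing, maximality would refute it from finitely many members of [w], and a cut on
    [a] would make [w] inconsistent. *)
Lemma mcs_deduce (s : seq (form P)) a : (forall b, List.In b s -> w b) ->
  classical a -> nd [set b | List.In b s] a -> w a.
Proof.
move=> sw ca sa; apply: contrapT => /(mcs_maximal mw ca)/inconsistentU1[t tw tbot].
apply: (mcs_consistent mw); exists (s ++ t).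
  by move=> b /List.in_app_iff[/sw|/tw].
apply: (@nd_cut _ a); first exact: classical_wf.
  by apply: nd_weaken sa => b bs; apply/List.in_app_iff; left.
apply: nd_weaken tbot; apply: setUS => b bt.
by apply/List.in_app_iff; right.
Qed.

Lemma mcs_deduce1 a b : classical b -> nd [set a] b -> w a -> w b.
Proof.
move=> cb ab wa; apply: (@mcs_deduce [:: a]) => // [c [<-|]//|].
by apply: nd_weaken ab => _ ->; left.
Qed.

Lemma mcs_neg a : classical a -> w (Neg a) <-> ~ w a.
Proof.
move=> ca; have wa := classical_wf ca; split=> [wna wa'|na].
  apply: (mcs_consistent mw); exists [:: a; Neg a] => [c [<-|[<-|]]//|].
  by apply: (nd_negE ca); apply: nd_assume => //=; [left|right; left].
have [s sw sbot] := inconsistentU1 (mcs_maximal mw ca na).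
by apply: mcs_deduce sw _ _ => //; exact: nd_negI.
Qed.

Lemma mcs_bot : ~ w Bot.
Proof.
move=> wbot; apply: (mcs_consistent mw); exists [:: Bot] => [c [<-|]//|].
by apply: nd_assume => //; left.
Qed.

Lemma mcs_and a b : classical a -> classical b -> w (And a b) <-> w a /\ w b.
Proof.
move=> ca cb; have wa := classical_wf ca; have wb := classical_wf cb.
have wab : nd [set And a b] (And a b) by apply: nd_hyp; rewrite /= wa.
split=> [h|[ha hb]].
  by split; apply: mcs_deduce1 h => //; [exact: nd_andEl wab|exact: nd_andEr wab].
apply: (@mcs_deduce [:: a; b]) => [c [<-|[<-|]]//||]; first by rewrite /= ca.
by apply: nd_andI; apply: nd_assume => //; [left|right; left].
Qed.

Lemma mcs_tensor a b : classical a -> classical b ->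
  w (Tensor a b) <-> w a \/ w b.
Proof.
move=> ca cb; have wa := classical_wf ca; have wb := classical_wf cb.
split=> [h|[h|h]]; last 2 first.
- by apply: mcs_deduce1 h; [rewrite /= ca|apply: nd_tensorI => //; exact: nd_hyp].
- apply: mcs_deduce1 h; first by rewrite /= ca.
  by apply/nd_tensorC/nd_tensorI => //; exact: nd_hyp.
apply: contrapT => /not_orP[/(mcs_neg ca) na /(mcs_neg cb) nb].
apply: mcs_bot; apply: (@mcs_deduce [:: Tensor a b; Neg a; Neg b]) => //.
  by move=> c [<-|[<-|[<-|]]].
(* The conclusion [Bot] is classical, so the tensor can be eliminated like a Boolean disjunction. *)
apply: (@nd_tensorE _ _ a b) => //.
- by apply: nd_assume; [rewrite /= wa|left].
- apply: (nd_negE ca); first exact: nd_hypU.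
  by apply: nd_assume => //; right; right; left.
- apply: (nd_negE cb); first exact: nd_hypU.
  by apply: nd_assume => //; right; right; right; left.
Qed.

Definition mcs_acc (u v : set (form P)) : Prop := forall b, u (Box b) -> v b.

(** Either [Neg a] contradicts finitely many boxed formulas of [w], and box monotonicity puts
    [Box a] in [w], or Lindenbaum extends [Neg a] and all of them to a successor omitting [a]. *)
Lemma mcs_box a : classical a ->
  w (Box a) <-> (forall v, maximal_consistent v -> mcs_acc w v -> v a).
Proof.
move=> ca; have wa := classical_wf ca; split=> [h v _|h]; first exact.
have [|cons] := pselect (inconsistent (Neg a |` [set b | w (Box b)])).
  move=> /inconsistentU1[s sw sbot].
  apply: (@mcs_deduce (List.map (@Box P) s)) => // [b /List.in_map_iff[c [<- /sw]]//|].
  apply: (@nd_boxMon _ _ s); last by apply: nd_dne => //; exact: nd_negI.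
  move=> b bs; apply: nd_assume; last exact: List.in_map.
  by apply/classical_wf/(mcs_classical mw); exact: sw.
have [|v mv Gv] := lindenbaum _ cons; first by move=> b [->//|/(mcs_classical mw)].
have va : v a by apply: h => // b wb; apply: Gv; right.
exfalso; apply: (mcs_consistent mv); exists [:: a; Neg a].
  by move=> c [<-//|[<-|//]]; apply: Gv; left.
by apply: (nd_negE ca); apply: nd_assume => //; [left|right; left].
Qed.

(** The duality rules speak of [Dia (Neg _)], so a double negation is inserted or removed under the
    diamond by monotonicity. *)
Lemma mcs_dia_box a : classical a -> w (Dia a) <-> ~ w (Box (Neg a)).
Proof.
move=> ca; have wa := classical_wf ca; rewrite -mcs_neg//; split; apply: mcs_deduce1 => //.
  apply: nd_diaNeg => //; apply: nd_dia1 => //; apply: nd_negI => //.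
  apply: (nd_negE ca); last exact: nd_hypU.
  by apply: nd_assume => //; right.
apply: (@nd_diaMon _ _ (Neg (Neg a))); first by apply: nd_negBox => //; exact: nd_hyp.
by apply: nd_dne => //; exact: nd_hyp.
Qed.

End MaximalConsistent.

Lemma mcs_dia w a : maximal_consistent w -> classical a ->
  w (Dia a) <-> exists2 v, maximal_consistent v /\ mcs_acc w v & v a.
Proof.
move=> mw ca; rewrite mcs_dia_box// mcs_box//; split.
  move=> /existsNP[v /not_implyP[mv /not_implyP[wv nva]]].
  by exists v => //; apply: contrapT => /(mcs_neg mv ca).
by move=> [v [mv wv] va] /(_ v mv wv)/(mcs_neg mv ca).
Qed.

(** * Truth lemma and completeness *)

Definition mcs : Type := {w : set (form P) | maximal_consistent w}.

(** The world [w0] witnesses that the model is nonempty; accessibility and valuation are the same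
    for every choice of it. *)
Definition canonical_model (w0 : mcs) : kripke P :=
  @Kripke P mcs (fun w v => mcs_acc (sval w) (sval v))
    (fun p => [set w | sval w (Var p)]) (ex_intro _ w0 Logic.I).

(** On singletons this is the usual truth lemma of K; flatness carries it over to the teams used
    below. *)
Lemma canonical_truth w0 a (w : world (canonical_model w0)) :
  classical a -> sat [set w] a <-> sval w a.
Proof.
have mw (v : world (canonical_model w0)) : maximal_consistent (sval v).
  exact: svalP.
elim: a w => // [p||a IH|a IHa b IHb|a IHa b IHb|a IH|a IH] w.
- by move=> _ /=; split=> [h|h _ ->//]; exact: (h w erefl).
- move=> _; split=> [/= /seteqP[h _]|/(mcs_bot (mw w))//].
  by have := h w erefl.
- by rewrite [classical _]/= => ca; rewrite sat_neg1 (mcs_neg (mw w))// IH.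
- by rewrite [classical _]/= => /andP[ca cb]; rewrite (mcs_and (mw w))// -IHa// -IHb.
- by rewrite [classical _]/= => /andP[ca cb]; rewrite sat_tensor1 (mcs_tensor (mw w))// IHa// IHb.
- rewrite [classical _]/= => ca; rewrite sat_box1// (mcs_box (mw w))//; split=> h v.
    by move=> mv /(h (exist _ v mv))/IH; apply.
  by move=> /(h _ (mw v)) /IH; apply.
- rewrite [classical _]/= => ca; rewrite sat_dia1// (mcs_dia (mw w))//; split.
    by move=> [v wv /IH va]; exists (sval v); [split|exact: va].
  by move=> [v [mv wv] va]; exists (exist _ v mv) => //; apply/IH.
Qed.

(** The team is fixed during the induction, so satisfying a disjunction directly selects the
    disjunct to be derived. *)
Lemma canonical_team_complete w0 a psi : classical a -> or_normal psi ->
  sat [set w : world (canonical_model w0) | sval w a] psi -> nd [set a] psi.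
Proof.
move=> ca; elim=> {psi} [b cb|phi psi n1 IH1 n2 IH2 /= [/IH1|/IH2]]; last 2 first.
- by apply: nd_orIl; exact: or_normal_wf.
- by apply: nd_orIr; exact: or_normal_wf.
move=> /classical_flat - /(_ cb) h; apply: contrapT => nab.
(* If [a] does not prove [b], some world contains [a] and [Neg b]; it belongs to the team and
   refutes [b]. *)
have [||v mv Gv] := @lindenbaum (Neg b |` [set a]).
- by move=> c [->|->].
- move=> [s sG sbot]; apply: nab; apply: nd_dne => //; apply: nd_negI => //.
  exact: nd_weaken sbot.
have : v b.
  have := h (exist _ v mv); rewrite canonical_truth//; apply.
  by apply: Gv; right.
by apply/(mcs_neg mv) => //; apply: Gv; left.
Qed.

Lemma entails_classical_complete a psi : classical a -> or_normal psi ->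
  entails a psi -> nd [set a] psi.
Proof.
move=> ca npsi h.
(* An inconsistent [a] proves everything; a consistent one lies in some maximal consistent set,
   which makes the canonical model nonempty. *)
have [[s sa sbot]|cons] := pselect (inconsistent [set a]).
  by apply: nd_exfalso; [exact: or_normal_wf|exact: nd_weaken sbot].
have [|w mw _] := @lindenbaum [set a] _ cons; first by move=> _ ->.
apply: (@canonical_team_complete (exist _ w mw)) => //; apply: h.
by apply/classical_flat => // v; rewrite canonical_truth.
Qed.

Lemma or_normal_complete phi psi : or_normal phi -> or_normal psi ->
  entails phi psi -> nd [set phi] psi.
Proof.
move=> n npsi; elim: n => {phi} [a ca|phi phi' n1 IH1 n2 IH2 h].
  exact: entails_classical_complete.
apply: nd_orE1; try exact: or_normal_wf.
  by apply: IH1 => M X ?; apply: h; left.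
by apply: IH2 => M X ?; apply: h; right.
Qed.

End ProofTheory.

Theorem theorem2p13 (P : Type) (phi psi : form P) :
  wf phi -> wf psi -> (entails phi psi <-> nd [set phi] psi).
Proof.
move=> wphi wpsi; split=> [h|h M X Xphi]; last first.
  by apply: (nd_sound h) => _ ->.
have [phi' n1 [_ w1 h1 h1']] := normalizable_wf wphi.
have [psi' n2 [_ w2 h2 h2']] := normalizable_wf wpsi.
(* The derivation runs from [phi] through both normal forms to [psi]; soundness of the normalizing
   derivations turns the given entailment into one between the normal forms. *)
apply: nd_cut1 w2 _ h2'; apply: nd_cut1 w1 h1 _.
apply: or_normal_complete => // M X X1.
apply: (nd_sound h2) => _ ->; apply: h.
by apply: (nd_sound h1') => _ ->.
Qed.
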